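(* Let $\kappa$ be an infinite cardinal. For any $T_1$-space $X$ the pair $(\mathsf W^\star_{\beta\kappa}X, j_X)$ has the following properties: (1) the identity map $\mathsf W^\star_{\beta\kappa}X\to \mathsf W_{\bar\kappa}X$ is continuous; (2) the map $j_X:X\to \mathsf W^\star_{\beta\kappa}X$ is a topological embedding; (3) the set $j_X(X)$ is dense in $\mathsf W^\star_{\beta\kappa}X$; (4) for any subspace $Z\subset \mathsf W_{\beta\kappa}X$ of density $d(Z)\le\kappa$ the identity inclusion $Z\to \mathsf W^\star_{\beta\kappa}X$ is a topological embedding; (5) the space $\mathsf W^\star_{\beta\kappa}X$ is $\kappa$-bounded; (6) for any continuous map $f:X\to Y$ to a Hausdorff $\kappa$-bounded space $Y$ there exists a unique continuous map $\bar f:\mathsf W^\star_{\beta\kappa}X\to Y$ such that $f=\bar f\circ j_X$; (7) the pair $(\mathsf W^\star_{\beta\kappa}X,j_X)$ is a reflection of $X$ in the class of Hausdorff $\kappa$-bounded spaces if and only if the space $\mathsf W^\star_{\beta\kappa}X$ is Hausdorff; (8) if $X$ is $\overline{\kappa}$-normal, then $(\mathsf W^\star_{\beta\kappa}X,j_X)$ is a reflection of $X$ in the class of Hausdorff $\kappa$-bounded spaces.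
   Context: Reflection: for a class $\mathsf T$ of topological spaces, a reflection of a space $X$ in $\mathsf T$ is a pair $(\mathsf TX,i_X)$ of a space $\mathsf TX\in\mathsf T$ and a continuous map $i_X:X\to\mathsf TX$ such that for any continuous map $f:X\to Y$ to a space $Y\in\mathsf T$ there is a unique continuous map $\bar f:\mathsf TX\to Y$ with $f=\bar f\circ i_X$. A space $X$ is $\kappa$-bounded if the closure in $X$ of any subset of cardinality $\le\kappa$ is compact (compactness does not include Hausdorff). A space $X$ is $\overline{\kappa}$-normal if for any $C\subset X$ with $|C|\le\kappa$ and any disjoint closed sets $A,B\subset\overline C$ there are disjoint open sets $V,W\subset X$ with $A\subset V$, $B\subset W$. A $T_1$-space is a space in which all finite subsets are closed. The density $d(Z)$ is the smallest cardinality of a dense subset of $Z$. Wallman extension: $\mathsf WX$ is the set of closed ultrafilters on $X$, i.e. families $\mathcal F$ of closed subsets of $X$ such that $\emptyset\notin\mathcal F$; $A\cap B\in\mathcal F$ for all $A,B\in\mathcal F$; and a closed set $F\subset X$ belongs to $\mathcal F$ if $F\cap A\neq\emptyset$ for every $A\in\mathcal F$. Its topology is generated by the base of sets $\langle U\rangle=\{\mathcal F\in\mathsf WX:\exists F\in\mathcal F\ (F\subset U)\}$, $U$ open in $X$. For a $T_1$-space $X$, $j_X:X\to\mathsf WX$ sends $x$ to the family of all closed sets containing $x$. Let $\beta\kappa$ be the set of all ultrafilters on $\kappa$. For $p\in\beta\kappa$ and a function $x:\kappa\to Z$ into a topological space $Z$, $\lim_p x$ is the set of points $\bar x\in Z$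 such that $x^{-1}(U)\in p$ for every neighborhood $U$ of $\bar x$. A set $A\subset Z$ is $\beta\kappa$-closed if $\lim_p x\subset A$ for every $x:\kappa\to A$ and $p\in\beta\kappa$. $\mathsf W_{\beta\kappa}X$ is the smallest $\beta\kappa$-closed subset of $\mathsf WX$ containing $j_X(X)$, with the subspace topology inherited from $\mathsf WX$. It coincides with the subspace $\mathsf W_{\bar\kappa}X=\bigcup\{\overline{j_X(C)}:C\subset X,\ |C|\le\kappa\}$ of $\mathsf WX$, where closures are taken in $\mathsf WX$. Let $\tau^\star$ be the topology on the set $\mathsf W_{\beta\kappa}X$ consisting of all sets $U\subset\mathsf W_{\beta\kappa}X$ such that $j_X^{-1}(U)$ is open in $X$ and, for every $C\subset X$ of cardinality $\le\kappa$, the set $\overline{j_X(C)}\setminus U$ is closed in $\mathsf W_{\bar\kappa}X$ (closure of $j_X(C)$ in $\mathsf WX$). Then $\mathsf W^\star_{\beta\kappa}X:=(\mathsf W_{\beta\kappa}X,\tau^\star)$, and $j_X$ is regarded as a map into it. *)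

(* Defs.v *)
From HB Require Import structures.
From mathcomp Require Import all_boot all_order all_algebra.
From mathcomp Require Import all_classical topology.

Set Implicit Arguments.
Unset Strict Implicit.
Unset Printing Implicit Defensive.

Local Open Scope classical_set_scope.
Local Open Scope card_scope.

(* A cardinal kappa is represented throughout by a type [K] of that cardinality,
   so [C #<= [set: K]] reads |C| <= kappa.  The T_1 axiom is the library's
   [accessible_space]; by [accessible_finite_set_closed] it says that all finite
   subsets are closed. *)

Section GeneralTopology.

Definition kappa_bounded (K : Type) (X : topologicalType) : Prop :=
  forall C : set X, C #<= [set: K] -> compact (closure C).

Definition kappa_normal (K : Type) (X : topologicalType) : Prop :=
  forall C : set X, C #<= [set: K] ->
  forall A B : set X, closed A -> closed B ->
    A `<=` closure C -> B `<=` closure C -> A `&` B = set0 ->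
  exists V W : set X,
    [/\ open V, open W, A `<=` V, B `<=` W & V `&` W = set0].

(* d(T) <= kappa, where d(T) is the least cardinality of a dense subset *)
Definition density_le (K : Type) (T : topologicalType) : Prop :=
  exists2 D : set T, dense D & D #<= [set: K].

(* a homeomorphism onto the subspace [range f] *)
Definition topological_embedding (X Y : topologicalType) (f : X -> Y) : Prop :=
  [/\ injective f,
      continuous f
    & forall U : set X, open U ->
        exists2 V : set Y, open V & f @` U = V `&` range f].

Definition is_reflection (Tc : topologicalType -> Prop)
    (X TX : topologicalType) (i : X -> TX) : Prop :=
  [/\ Tc TX,
      continuous i
    & forall Y : topologicalType, Tc Y -> forall f : X -> Y, continuous f ->
        exists! g : TX -> Y, continuous g /\ f = g \o i].

Definition hausdorff_kappa_bounded (K : Type) (Y : topologicalType) : Prop :=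
  hausdorff_space Y /\ kappa_bounded K Y.

(* lim_p x is [set z | x @ p --> z] *)
Definition beta_closed (K : Type) (Z : topologicalType) (A : set Z) : Prop :=
  forall (x : K -> Z) (p : set_system K), (forall k, A (x k)) ->
    UltraFilter p -> [set z : Z | x @ p --> z] `<=` A.

End GeneralTopology.

Record closed_ultrafilter (X : topologicalType) (F : set (set X)) : Prop := {
  cuf_closed : forall A, F A -> closed A;
  cuf_proper : ~ F set0;
  cuf_setI : forall A B, F A -> F B -> F (A `&` B);
  cuf_max : forall A, closed A -> (forall B, F B -> A `&` B !=set0) -> F A
}.

Record wallman (X : topologicalType) := Wallman {
  wallman_family :> set (set X);
  wallmanP : closed_ultrafilter wallman_family
}.

HB.instance Definition _ (X : topologicalType) := gen_eqMixin (wallman X).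
HB.instance Definition _ (X : topologicalType) := gen_choiceMixin (wallman X).

Section Wallman.
Variable X : topologicalType.

Lemma wallman_inj (F G : wallman X) :
  wallman_family F = wallman_family G -> F = G.
Proof.
case: F G => [F hF] [G hG] /= FG; case: _ / FG hG => hG.
by rewrite (Prop_irrelevance hF hG).
Qed.

Definition wallman_base (U : set X) : set (wallman X) :=
  [set F | exists2 A, wallman_family F A & A `<=` U].

Let wallman_base_cover :
  \bigcup_(U in [set U : set X | open U]) wallman_base U = setT.
Proof.
apply/seteqP; split=> // F _; exists setT; first exact: openT.
exists setT => //; apply: (cuf_max (wallmanP F)) => [|B FB].
  exact: closedT.
rewrite setTI; apply/set0P/eqP => B0.
by apply: (cuf_proper (wallmanP F)); rewrite -B0.
Qed.

Let wallman_base_join (U V : set X) (F : wallman X) :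
  [set U : set X | open U] U -> [set U : set X | open U] V ->
  wallman_base U F -> wallman_base V F ->
  exists W, [/\ [set U : set X | open U] W, wallman_base W F
    & wallman_base W `<=` wallman_base U `&` wallman_base V].
Proof.
move=> oU oV [A FA AU] [B FB BV]; exists (U `&` V); split.
- exact: openI.
- exists (A `&` B); first exact: (cuf_setI (wallmanP F)).
  by move=> x [/AU Ux /BV Vx].
- by move=> G [D GD DUV]; split; exists D => // x /DUV[].
Qed.

HB.instance Definition _ := isBaseTopological.Build (wallman X)
  wallman_base_cover wallman_base_join.

Hypothesis hX : accessible_space X.

Lemma principal_closed_ultrafilter (x : X) :
  closed_ultrafilter [set A : set X | closed A /\ A x].
Proof.
split=> [A []//|[]//|A B [cA Ax] [cB Bx]|A cA hA].
  by split=> //; exact: closedI.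
split=> //; have [|y [Ay /= <-//]] := hA [set x].
by split=> //; exact: accessible_closed_set1.
Qed.

Definition wallman_j (x : X) : wallman X :=
  Wallman (principal_closed_ultrafilter x).

Variable K : Type.

(* the underlying set of W_{beta kappa} X *)
Definition wallman_beta : set (wallman X) :=
  smallest (@beta_closed K (wallman X)) (range wallman_j).

(* the underlying set of W_{bar kappa} X *)
Definition wallman_bar : set (wallman X) :=
  \bigcup_(C in [set C : set X | C #<= [set: K]]) closure (wallman_j @` C).

Lemma closure_wallman_beta (C : set X) : C #<= [set: K] ->
  closure (wallman_j @` C) `<=` wallman_beta.
Proof.
move=> /pfcard_geP[->|]; first by rewrite image_set0 closure0.
case=> g; have gC : g @` setT = C by apply/seteqP; split;
  [move=> _ [k _ <-]; exact: funS|exact: (@surj _ _ _ _ g)].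
move=> F clF A [bA jA].
pose x (k : K) := wallman_j (g k).
pose G : set_system K := filter_from (nbhs F) (fun U => x @^-1` U).
have GF : ProperFilter G.
  apply: filter_from_proper.
    apply: filter_from_filter; first by exists setT; exact: filterT.
    by move=> U V nU nV; exists (U `&` V) => //; exact: filterI.
  move=> U /clF[_ [[c Cc <-]] Uc]; move: Cc Uc; rewrite -gC => -[k _ <-] Uk.
  by exists k.
have [p [pU Gp]] := ultraFilterLemma GF.
apply: (bA x p _ pU) => [k|]; first by apply: jA; exists (g k).
by move=> U nU; apply: Gp; exists U.
Qed.

Lemma wallman_j_beta (x : X) : wallman_j x \in wallman_beta.
Proof. by apply/mem_set => A [_ jA]; apply: jA; exists x. Qed.

Definition wallman_beta_j (x : X) : set_type wallman_beta :=
  exist _ (wallman_j x) (wallman_j_beta x).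

(* The topology tau^*: the closure is taken in [wallman X], and the set
   closure (j @` C) `\` U is closed as a subset of the subspace W_{bar kappa} X.
   The subspace topology on W_{beta kappa} X is the library's topology on
   [set_type wallman_beta]; [wallman_star] is the same type with tau^*. *)
Definition star_open (U : set (set_type wallman_beta)) : Prop :=
  open (wallman_beta_j @^-1` U) /\
  forall C : set X, C #<= [set: K] ->
    closed ((set_val : set_type wallman_bar -> wallman X) @^-1`
              (closure (wallman_j @` C) `\` set_val @` U)).

Definition wallman_star : Type := set_type wallman_beta.

HB.instance Definition _ := Choice.on wallman_star.

Let closed_preimage_val (E : set (wallman X)) : closed E ->
  closed ((set_val : set_type wallman_bar -> wallman X) @^-1` E).
Proof.
by apply: preimage_closed => F _; exact: initial_continuous.
Qed.

Let star_openT : star_open [set: wallman_star].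
Proof.
split=> [|C CK]; first by rewrite preimage_setT; exact: openT.
rewrite (_ : _ `\` _ = set0) ?preimage_set0; first exact: closed0.
rewrite -subset0 => F [clF]; apply.
by exists (exist _ F (mem_set (closure_wallman_beta CK clF))).
Qed.

Let star_openI : setI_closed (star_open : set_system wallman_star).
Proof.
move=> U V [oU hU] [oV hV]; split=> [|C CK]; first exact: openI.
rewrite (_ : _ @` (U `&` V) = set_val @` U `&` set_val @` V).
  by rewrite setDIr preimage_setU; apply: closedU; [exact: hU|exact: hV].
apply/seteqP; split=> [_ [u [Uu Vu] <-]|_ [[u Uu <-] [v Vv /val_inj uv]]].
  by split; exists u.
by exists u => //; split=> //; rewrite -uv.
Qed.

Let star_open_bigU (I : Type) (f : I -> set wallman_star) :
  (forall i, star_open (f i)) -> star_open (\bigcup_i f i).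
Proof.
move=> hf; split=> [|C CK].
  rewrite preimage_bigcup; apply: bigcup_open => i _; exact: (hf i).1.
rewrite (_ : _ @^-1` _ = set_val @^-1` closure (wallman_j @` C) `&`
  \bigcap_i set_val @^-1` (closure (wallman_j @` C) `\` set_val @` (f i))).
  apply: closedI; first by apply: closed_preimage_val; exact: closed_closure.
  by apply: closed_bigI => i _; exact: (hf i).2.
apply/seteqP; split=> F /= [clF nF].
  by split=> // i _; split=> // -[u fu uF]; apply: nF; exists u => //; exists i.
by split=> // -[u [i _ fu] uF]; have [_] := nF i Logic.I; apply; exists u.
Qed.

HB.instance Definition _ := isOpenTopological.Build wallman_star
  star_openT star_openI star_open_bigU.

Definition wallman_star_j (x : X) : wallman_star := wallman_beta_j x.

End Wallman.

(* Main.v *)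
Require Import Defs.
From mathcomp Require Import all_boot all_order all_algebra.
From mathcomp Require Import all_classical topology.

Set Implicit Arguments.
Unset Strict Implicit.
Unset Printing Implicit Defensive.

Local Open Scope classical_set_scope.
Local Open Scope card_scope.

(* Every point of W_{bar kappa} X lies in a compact set Q = cl j(C) with
   |C| <= kappa, and kappa * kappa = kappa puts any kappa many points into a
   single such Q.  On Q the topology tau^* agrees with that of W X, since Q \ U
   is closed for every U in tau^*.  This local agreement gives kappa-boundedness,
   the embedding of small subspaces and the continuity of extensions.

   A continuous f : X -> Y sends a closed ultrafilter F in Q to a filter base in
   the compact Hausdorff set cl f(C); regularity of that set and the maximality
   of F make it converge, and the extension of f maps F to its limit.  If X is
   kappa-normal, distinct F and G in Q contain disjoint closed subsets of cl C,
   and the open sets separating these in X separate F from G. *)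

(** * Cardinal arithmetic *)

(** A point of [K] supplies the values of [f] outside [A]. *)
Lemma card_leT_injP (T K : Type) (A : set T) : [set: K] !=set0 ->
  A #<= [set: K] <-> exists f : T -> K, set_inj A f.
Proof.
elim/Ppointed: K => K [k0 _]; first by case: (no k0).
by split => [/pcard_injP//|fA]; exact/pcard_injP.
Qed.

Lemma nat_inj_infinite (K : Type) : infinite_set [set: K] ->
  exists e : nat -> K, injective e.
Proof.
move=> Kinf; have [k0] : [set: K] !=set0.
  by apply/set0P/eqP => K0; apply: Kinf; rewrite K0.
move=> k0T; move/infiniteP: Kinf => /card_leT_injP[]; first by exists k0.
by move=> e einj; exists e => m n /einj; apply; rewrite inE.
Qed.

(* A maximal matching between A and B exhausts one of them. *)
Lemma inj_total (T : Type) (t0 : T) (A B : set T) :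
  (exists2 f : T -> T, set_fun A B f & set_inj A f) \/
  (exists2 f : T -> T, set_fun B A f & set_inj B f).
Proof.
pose P (R : set (T * T)) := (forall p, R p -> A p.1 /\ B p.2) /\
  (forall p q, R p -> R q -> p.1 = q.1 \/ p.2 = q.2 -> p = q).
have [F FP Ftot|R [[RAB Rinj] Rmax]] := @Zorn_bigcup _ P.
  split=> [p [R /FP[RAB _] /RAB]//|p q [R FR Rp] [S FS Sq]].
  have [RS|SR] := Ftot _ _ FR FS.
    by have [_] := FP _ FS; apply => //; exact: RS.
  by have [_] := FP _ FR; apply => //; exact: SR.
have [RA|/existsNP[a /not_implyP[Aa aR]]] :=
  pselect (forall a, A a -> exists b, R (a, b)).
  left; have /choice[f fR] : forall a, exists b, A a -> R (a, b).
    move=> a; have [/RA[b]|] := pselect (A a); first by exists b.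
    by move=> nAa; exists t0.
  exists f => [a /fR/RAB[]//|a a' /set_mem/fR Ra /set_mem/fR Ra' faa'].
  by have [] := Rinj _ _ Ra Ra' (or_intror faa').
have [RB|/existsNP[b /not_implyP[Bb bR]]] :=
  pselect (forall b, B b -> exists a, R (a, b)).
  right; have /choice[f fR] : forall b, exists a, B b -> R (a, b).
    move=> b; have [/RB[c]|] := pselect (B b); first by exists c.
    by move=> nBb; exists t0.
  exists f => [b /fR/RAB[]//|b b' /set_mem/fR Rb /set_mem/fR Rb' fbb'].
  by have [] := Rinj _ _ Rb Rb' (or_introl fbb').
exfalso; apply: (Rmax (R `|` [set (a, b)])).
  split; first exact: subsetUl.
  by move=> /(_ (a, b))Rab; apply: aR; exists b; apply: Rab; right.
split=> [p [/RAB//|->//]|[p1 p2] [q1 q2] [Rp|[-> ->]] [Rq|[-> ->]]//=].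
- by move=> e; exact: Rinj Rp Rq e.
- by case=> e; [case: aR; exists p2; rewrite -e|case: bR; exists p1; rewrite -e].
- by case=> e; [case: aR; exists q2; rewrite e|case: bR; exists q1; rewrite e].
Qed.

(** * Partial pairing functions and the equality kappa * kappa = kappa *)

Section Square.
Variables (T : Type) (t0 t1 : T).

(** A pairing function on [A], that is, an injection of A x A into [A]; [t0] and [t1] will serve as
    labels of two sheets. *)
Definition square_inj (A : set T) (f : T -> T -> T) :=
  [/\ A t0, A t1, forall x y, A x -> A y -> A (f x y) &
   forall x y x' y', A x -> A y -> A x' -> A y' ->
     f x y = f x' y' -> x = x' /\ y = y'].

Definition square_le (p q : set T * (T -> T -> T)) :=
  p.1 `<=` q.1 /\ forall x y, p.1 x -> p.1 y -> p.2 x y = q.2 x y.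

Lemma square_le_trans p q r : square_le p q -> square_le q r -> square_le p r.
Proof.
move=> [pq epq] [qr eqr]; split; first exact: subset_trans pq qr.
by move=> x y px py; rewrite epq// eqr//; exact: pq.
Qed.

(** The pairings of a chain glue to one on the union of their domains: finitely many points always
    lie in a common domain, and the pairings agree there. *)
Lemma square_inj_chain (F : set (set T * (T -> T -> T))) : F !=set0 ->
  (forall p, F p -> square_inj p.1 p.2) -> total_on F square_le ->
  exists2 q, square_inj q.1 q.2 & forall p, F p -> square_le p q.
Proof.
move=> [p0 Fp0] Fsq Ftot.
pose A := \bigcup_(p in F) p.1.
have AF x y : A x -> A y -> exists2 p, F p & p.1 x /\ p.1 y.
  move=> [p Fp px] [q Fq qy]; have [[pq _]|[qp _]] := Ftot _ _ Fp Fq.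
    by exists q => //; split => //; exact: pq.
  by exists p => //; split => //; exact: qp.
(* Members of the chain that contain both coordinates give the same value; [t0] is a dummy value for
   pairs that no member contains. *)
have /choice[f' f'E] : forall xy, exists z,
    forall p, F p -> p.1 xy.1 -> p.1 xy.2 -> z = p.2 xy.1 xy.2.
  case=> x y /=; have [[p [Fp px py]]|np] := pselect (exists p, [/\ F p, p.1 x & p.1 y]).
    exists (p.2 x y) => q Fq qx qy.
    by have [[_ ->]|[_ ->]] := Ftot _ _ Fp Fq.
  by exists t0 => p Fp px py; case: np; exists p.
exists (A, fun x y => f' (x, y)) => [|p Fp]; last first.
  split => [x px|x y px py] /=; first by exists p.
  by rewrite (f'E (_, _) _ Fp).
have AF4 x y x' y' : A x -> A y -> A x' -> A y' ->
    exists2 p, F p & [/\ p.1 x, p.1 y, p.1 x' & p.1 y'].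
  move=> Ax Ay Ax' Ay'; have [p Fp [px py]] := AF _ _ Ax Ay.
  have [q Fq [qx' qy']] := AF _ _ Ax' Ay'.
  have [[pq _]|[qp _]] := Ftot _ _ Fp Fq.
    by exists q => //; split => //; exact: pq.
  by exists p => //; split => //; exact: qp.
have [p0t0 p0t1 _ _] := Fsq _ Fp0.
split=> /=; [by exists p0|by exists p0| |].
- move=> x y Ax Ay; have [p Fp [px py]] := AF _ _ Ax Ay.
  rewrite (f'E (_, _) _ Fp px py); exists p => //.
  by have [_ _ pin _] := Fsq _ Fp; exact: pin.
- move=> x y x' y' Ax Ay Ax' Ay'.
  have [p Fp [px py px' py']] := AF4 _ _ _ _ Ax Ay Ax' Ay'.
  rewrite (f'E (_, _) _ Fp px py) (f'E (_, _) _ Fp px' py').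
  by have [_ _ _ pinj] := Fsq _ Fp; exact: pinj.
Qed.

(* g copies A onto a disjoint set g(A); a new pair (x, y) is coded in g(A) by
   the elements of A below x and y, and by the two sheets they lie on. *)
Lemma square_inj_extend (A : set T) (f : T -> T -> T) (g : T -> T) :
  t0 <> t1 -> square_inj A f -> set_fun A (~` A) g -> set_inj A g ->
  exists2 f', square_inj (A `|` g @` A) f' &
    square_le (A, f) (A `|` g @` A, f').
Proof.
move=> t01 [A0 A1 fA finj] gA ginj.
(* [r] projects both sheets to [A]: it is the identity on [A] and inverts [g] on g(A). *)
have /choice[r rP] : forall x, exists y, (A `|` g @` A) x ->
    A y /\ (A x -> x = y) /\ (~ A x -> x = g y).
  move=> x; have [Ax|nAx] := pselect (A x); first by exists x.
  have [[y Ay gyx]|ngx] := pselect ((g @` A) x).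
    by exists y => _; split=> //; split.
  by exists x; case.
pose c x := if pselect (A x) then t0 else t1.
have cA x : A (c x) by rewrite /c; case: pselect.
have rcinj x y : (A `|` g @` A) x -> (A `|` g @` A) y ->
    r x = r y -> c x = c y -> x = y.
  move=> Bx By rxy; have [_ [rx grx]] := rP _ Bx; have [_ [ry gry]] := rP _ By.
  rewrite /c; case: pselect => Ax; case: pselect => Ay.
  - by move=> _; rewrite (rx Ax) rxy -(ry Ay).
  - by move=> /t01.
  - by move=> /esym/t01.
  - by move=> _; rewrite (grx Ax) rxy -(gry Ay).
pose h x y := f (f (r x) (r y)) (f (c x) (c y)).
pose f' x y := if pselect (A x /\ A y) then f x y else g (h x y).
have hA x y : (A `|` g @` A) x -> (A `|` g @` A) y -> A (h x y).
  by move=> /rP[Arx _] /rP[Ary _]; apply: (fA); apply: (fA).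
exists f'; last first.
  split; first exact: subsetUl.
  by move=> x y Ax Ay /=; rewrite /f'; case: pselect => // -[].
split; [by left|by left| |].
- move=> x y Bx By; rewrite /f'; case: pselect => [[Ax Ay]|nA] /=.
    by left; exact: fA.
  by right; exists (h x y) => //; exact: hA.
- move=> x y x' y' Bx By Bx' By'; rewrite /f'.
  case: pselect => [[Ax Ay]|nA] /=; case: pselect => [[Ax' Ay']|nA'] /=.
  + exact: finj.
  + by move=> e; case: (gA _ (hA _ _ Bx' By')); rewrite -e; exact: fA.
  + by move=> e; case: (gA _ (hA _ _ Bx By)); rewrite e; exact: fA.
  + move=> /ginj; rewrite !inE => /(_ (hA _ _ Bx By) (hA _ _ Bx' By')).
    have [Arx _] := rP _ Bx; have [Ary _] := rP _ By.
    have [Arx' _] := rP _ Bx'; have [Ary' _] := rP _ By'.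
    move=> /finj[]; [exact: fA|exact: fA|exact: fA|exact: fA|].
    move=> /finj[]// rx ry /finj[]// cx cy.
    by split; apply: rcinj.
Qed.

End Square.

(** Take a maximal pairing, with domain [A]. If [A] injected into its complement, the pairing would
    extend. So the complement injects into [A], hence [K] embeds into A x A and then into [A], and
    the pairing pulls back to [K]. *)
Lemma infinite_square (K : Type) : infinite_set [set: K] ->
  exists s : K -> K -> K,
    forall x y x' y', s x y = s x' y' -> x = x' /\ y = y'.
Proof.
move=> /nat_inj_infinite[e einj].
pose t0 := e 0%N; pose t1 := e 1%N.
have t01 : t0 <> t1 by move/einj.
have [f0 f0sq] : exists f0, square_inj t0 t1 (range e) f0.
  have [d dK] : exists d : K -> nat, cancel e d.
    have /choice[d dP] : forall k, exists n, range e k -> e n = k.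
      move=> k; have [[n _ ek]|nk] := pselect (range e k); first by exists n.
      by exists 0%N.
    by exists d => n; apply: einj; apply: dP; exists n.
  (* The starting point is a countable set, with the pairing carried over from the natural
     numbers. *)
  exists (fun x y => e (choice.pickle (d x, d y))); split.
  - by exists 0%N.
  - by exists 1%N.
  - by move=> x y _ _; eexists.
  - move=> x y x' y' [a _ <-] [b _ <-] [a' _ <-] [b' _ <-] /einj.
    by rewrite !dK => /(pcan_inj choice.pickleK)[-> ->].
pose S := {p : set K * (K -> K -> K) | square_inj t0 t1 p.1 p.2}.
pose le (p q : S) := `[< square_le (sval p) (sval q) >].
pose p0 : S := exist _ (range e, f0) f0sq.
have [|||[[A f] /= Asq] Amax] := @ZL_preorder S p0 le.
- by move=> p; apply/asboolP; split.
- move=> q p r /asboolP qp /asboolP pr; apply/asboolP.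
  exact: square_le_trans qp pr.
- move=> F Ftot; have [[p Fp]|F0] := pselect (F !=set0); last first.
    by exists p0 => p Fp; case: F0; exists p.
  have [|||q qsq Fq] := @square_inj_chain K t0 t1 (sval @` F).
  + by exists (sval p); exists p.
  + by move=> _ [q _ <-]; exact: (svalP q).
  + move=> _ _ [q Fq <-] [r Fr <-].
    by have [/asboolP|/asboolP] := Ftot _ _ Fq Fr; [left|right].
  exists (exist _ q qsq) => r Fr; apply/asboolP; apply: Fq.
  by exists r.
have [A0 A1 fA finj] := Asq.
have [[g gA ginj]|[g gA ginj]] := inj_total t0 A (~` A).
  have [f' f'sq ff'] := square_inj_extend t01 Asq gA ginj.
  have := Amax (exist _ (A `|` g @` A, f') f'sq).
  (* Maximality would put [g t0] into [A], but [g] takes values outside [A]. *)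
  move=> /(_ (asboolT ff'))/asboolP[/= /(_ (g t0))].
  move=> gA0 _; case: (gA _ A0); apply: gA0.
  by right; exists t0.
(* The second coordinate, [t0] or [t1], records whether the point lies in [A]. *)
pose s x := if pselect (A x) then f x t0 else f (g x) t1.
have sA x : A (s x).
  rewrite /s; case: pselect => [Ax|nAx]; first exact: fA.
  by apply: fA => //; exact: gA.
have sinj : injective s.
  move=> x y; rewrite /s; case: pselect => Ax; case: pselect => Ay.
  - by move=> /finj[].
  - by move=> /finj[]//; exact: gA.
  - by move=> /finj[]//; [exact: gA|move=> _ /esym].
  - move=> /finj[]//; [exact: gA|exact: gA|].
    by move=> /ginj + _; apply; rewrite inE.
by exists (fun x y => f (s x) (s y)) => x y x' y' /finj[]// /sinj -> /sinj ->.
Qed.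

(** Code a point of the union by pairing the code of a chosen index with the code of the point in
    that member. *)
Lemma card_bigcup_le (K T I : Type) (D : set I) (C : I -> set T) :
  infinite_set [set: K] -> D #<= [set: K] ->
  (forall i, D i -> C i #<= [set: K]) ->
  \bigcup_(i in D) C i #<= [set: K].
Proof.
move=> Kinf DK CK; have [s sinj] := infinite_square Kinf.
have [e _] := nat_inj_infinite Kinf.
have K0 : [set: K] !=set0 by exists (e 0%N).
have [d dinj] := (card_leT_injP D K0).1 DK.
have /choice[c cinj] : forall i, exists c : T -> K, D i -> set_inj (C i) c.
  move=> i; have [/CK/(card_leT_injP _ K0)[c cinj]|nDi] := pselect (D i).
    by exists c.
  by exists (fun=> e 0%N).
(* [option I] provides a default value even if [I] is empty. *)
have /choice[i iP] : forall x, exists i : option I,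
    (\bigcup_(i in D) C i) x -> exists2 j, i = Some j & D j /\ C j x.
  move=> x; have [[j Dj Cj]|] := pselect ((\bigcup_(i in D) C i) x).
    by exists (Some j); exists j.
  by move=> nx; exists None.
apply/(card_leT_injP _ K0).
exists (fun x => if i x is Some j then s (d j) (c j x) else e 0%N).
move=> x y /set_mem/iP[j -> [Dj Cjx]] /set_mem/iP[k -> [Dk Cky]] /sinj[].
move=> /dinj; rewrite !inE => /(_ Dj Dk) jk; rewrite -{}jk in Dk Cky *.
by move=> /cinj; apply => //; rewrite inE.
Qed.

(** * The Wallman extension *)

Section Wallman.
Variable X : topologicalType.
Implicit Types (U A B : set X) (F G : wallman X).

Lemma open_wallman_base U : open U -> open (wallman_base U).
Proof. by move=> oU; exists [set U]; [move=> _ ->|rewrite bigcup_set1]. Qed.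

Lemma open_wallmanP (W : set (wallman X)) F : open W -> W F ->
  exists U, [/\ open U, wallman_base U F & wallman_base U `<=` W].
Proof.
move=> [D' D'o <-] [U D'U UF]; exists U; split=> //; first exact: D'o.
by move=> G UG; exists U.
Qed.

Lemma wallman_meet F A B : wallman_family F A -> wallman_family F B -> A `&` B !=set0.
Proof.
move=> FA FB; apply/set0P/eqP => AB0; apply: (cuf_proper (wallmanP F)).
by rewrite -AB0; exact: (cuf_setI (wallmanP F)).
Qed.

Lemma wallman_setS F A B : wallman_family F A -> closed B -> A `<=` B ->
  wallman_family F B.
Proof.
move=> FA cB AB; apply: (cuf_max (wallmanP F)) => // C FC.
by have [x [Ax Cx]] := wallman_meet FA FC; exists x; split=> //; exact: AB.
Qed.

Lemma wallman_setT F : wallman_family F [set: X].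
Proof.
apply: (cuf_max (wallmanP F)) => [|A FA]; first exact: closedT.
by rewrite setTI -[A]setIid; exact: (wallman_meet FA).
Qed.

Lemma wallman_disjoint F A : closed A -> ~ wallman_family F A ->
  exists2 B, wallman_family F B & A `&` B = set0.
Proof.
move=> cA nFA; apply: contrapT => nB; apply: nFA.
apply: (cuf_max (wallmanP F)) => // B FB; apply/set0P/eqP => AB0.
by apply: nB; exists B.
Qed.

(** Hence the sets of all closed ultrafilters containing a given closed set form a base of closed
    sets. *)
Lemma wallman_baseC F U : open U -> (~ wallman_base U F) <->
  wallman_family F (~` U).
Proof.
move=> oU; split=> [nUF|FU [A FA AU]].
  apply: contrapT => /(wallman_disjoint (open_closedC oU))[B FB].
  rewrite setIC => /disjoints_subset; rewrite setCK => BU.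
  by apply: nUF; exists B.
by have [x [nUx /AU]] := wallman_meet FU FA.
Qed.

Lemma wallman_baseI U V : wallman_base U `&` wallman_base V `<=`
  wallman_base (U `&` V).
Proof.
move=> F [[A FA AU] [B FB BV]]; exists (A `&` B).
  exact: (cuf_setI (wallmanP F)).
exact: setISS.
Qed.

Lemma wallman_base0 : wallman_base (@set0 X) = set0.
Proof.
rewrite -subset0 => F [A FA]; rewrite subset0 => A0.
by apply: (cuf_proper (wallmanP F)); rewrite -A0.
Qed.

Lemma wallman_eq F G : (forall A, wallman_family F A -> wallman_family G A) -> F = G.
Proof.
move=> FG; apply: wallman_inj; apply/seteqP; split=> A; first exact: FG.
move=> GA; apply: (cuf_max (wallmanP F)); first exact: (cuf_closed (wallmanP G)).
by move=> B /FG; exact: wallman_meet.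
Qed.

(** Zorn's lemma is applied to the part [H] added to [E], so that the empty union, arising from the
    empty chain, is admissible. *)
Lemma wallman_extend (E : set (set X)) : E `<=` closed -> ~ E set0 ->
  E setT -> setI_closed E -> exists F : wallman X,
    forall A, E A -> wallman_family F A.
Proof.
move=> Ecl E0 ET EI.
pose P (H : set (set X)) := [/\ H `<=` closed,
  ~ (E `|` H) set0 & setI_closed (E `|` H)].
have [H HP Htot|H [[Hcl H0 HI] Hmax]] := @Zorn_bigcup _ P.
  split.
  - by move=> A [G /HP[Gcl _ _] /Gcl].
  - move=> [//|[G /HP[_ G0 _] GG]]; apply: G0; by right.
  - move=> A B [EA|[G HG GA]] [EB|[G' HG' G'B]].
    + by left; exact: EI.
    + have [_ _ /(_ A B)[||EAB|GAB]] := HP _ HG'; [by left|by right|by left|].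
      by right; exists G'.
    + have [_ _ /(_ A B)[||EAB|GAB]] := HP _ HG; [by right|by left|by left|].
      by right; exists G.
    + have [GG'|G'G] := Htot _ _ HG HG'.
        have [_ _ /(_ A B)[||EAB|GAB]] := HP _ HG'.
        * by right; exact: GG'.
        * by right.
        * by left.
        * by right; exists G'.
      have [_ _ /(_ A B)[||EAB|GAB]] := HP _ HG.
      * by right.
      * by right; exact: G'G.
      * by left.
      * by right; exists G.
have EHcl : (E `|` H) `<=` closed by move=> A [/Ecl|/Hcl].
have EHF : closed_ultrafilter (E `|` H).
  split; [exact: EHcl|exact: H0|by move=> A B; exact: HI|].
  move=> A clA Ameet; apply: contrapT => nA.
  (* Adjoining all traces on [A] keeps the family proper and closed under intersections, and it adds
     [A] itself as the trace of the whole space. *)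
  pose H' := H `|` [set A `&` B | B in E `|` H].
  have EH'E : E `|` H' = (E `|` H) `|` [set A `&` B | B in E `|` H].
    by rewrite setUA.
  apply: (Hmax H').
    split; first exact: subsetUl.
    move=> H'H; apply: nA; right; apply: H'H; right; exists setT; first by left.
    by rewrite setIT.
  split.
  - by move=> B [/Hcl//|[C /EHcl clC <-]]; exact: closedI.
  - rewrite EH'E => -[//|[C /Ameet[x Cx] AC0]].
    by rewrite AC0 in Cx.
  - rewrite EH'E => B C [EB|[B' EB' <-]] [EC|[C' EC' <-]].
    + by left; exact: HI.
    + by right; exists (B `&` C'); [exact: HI|rewrite setICA].
    + by right; exists (B' `&` C); [exact: HI|rewrite setIA].
    + by right; exists (B' `&` C'); [exact: HI|rewrite setIACA setIid].
by exists (Wallman EHF) => A EA; left.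
Qed.

(** For an ultrafilter [G] on the extension, the closed sets that belong to [G]-almost every point
    form a proper filter base. Any closed ultrafilter [F] containing it is a limit: if a basic
    neighborhood of [F] were not in [G], the complement of its open set would belong to [F]. *)
Lemma wallman_compact : compact [set: wallman X].
Proof.
rewrite compact_ultra => G GU _.
pose E : set (set X) := [set A | closed A /\ G [set F : wallman X | wallman_family F A]].
have [||||F EF] := @wallman_extend E.
- by move=> A [].
- move=> [_ G0]; apply: (@filter_not_empty _ G).
  by apply: filterS G0 => F /(cuf_proper (wallmanP F)).
- by split; [exact: closedT|apply: filterS filterT => F _; exact: wallman_setT].
- move=> A B [clA GA] [clB GB]; split; first exact: closedI.
  apply: filterS (filterI GA GB) => F [FA FB].
  exact: (cuf_setI (wallmanP F)).
exists F; split=> // W; rewrite nbhsE => -[V [oV VF] VW].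
have [U [oU UF UV]] := open_wallmanP oV VF.
apply: filterS VW _; apply: filterS UV _.
have [//|GnU] := in_ultra_setVsetC (wallman_base U) GU.
suff /(wallman_baseC _ oU) : wallman_family F (~` U) by [].
apply: EF; split; first exact: open_closedC.
by apply: filterS GnU => H /(wallman_baseC _ oU).
Qed.

Variable hX : accessible_space X.
Local Notation j := (wallman_j hX).

Lemma wallman_base_j U x : open U -> wallman_base U (j x) <-> U x.
Proof.
move=> oU; split=> [[A [clA Ax] /(_ x Ax)]//|Ux].
exists [set x]; last by move=> _ ->.
by split=> //; exact: accessible_closed_set1.
Qed.

Lemma wallman_j_continuous : continuous j.
Proof.
apply/continuousP => W oW; rewrite openE => x Wjx.
have [U [oU Ujx UW]] := open_wallmanP oW Wjx.
rewrite /interior nbhsE; exists U; first by split=> //; exact/(wallman_base_j _ oU).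
by move=> y Uy; apply: UW; exact/wallman_base_j.
Qed.

Lemma wallman_j_inj : injective j.
Proof.
move=> x y xy; have [_ //] : wallman_family (j y) [set x].
by rewrite -xy; split=> //; exact: accessible_closed_set1.
Qed.

(** Reduces the closure in the extension to a single membership, which is how points of cl j(C) are
    handled below. *)
Lemma closure_wallman_j (C : set X) F :
  closure (j @` C) F <-> wallman_family F (closure C).
Proof.
split=> [clF|FC W].
  apply: contrapT => /(wallman_disjoint (@closed_closure _ C))[B FB CB0].
  pose U := ~` closure C; have oU : open U.
    by apply: closed_openC; exact: closed_closure.
  have [] := clF (wallman_base U).
    apply: open_nbhs_nbhs; split; first exact: open_wallman_base.
    by exists B => //; apply/disjoints_subset; rewrite setIC.
  move=> _ [[x Cx <-] /(wallman_base_j _ oU)]; apply; exact: subset_closure.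
rewrite nbhsE => -[V [oV VF] VW].
have [U [oU [A FA AU] UV]] := open_wallmanP oV VF.
have [x [Ax clx]] := wallman_meet FA FC.
have [|c [Cc Uc]] := clx U; first by apply: open_nbhs_nbhs; split=> //; exact: AU.
exists (j c); split; first by exists c.
by apply: VW; apply: UV; exact/wallman_base_j.
Qed.

(** * Subsets of size at most kappa in the Wallman extension *)

Section Cardinal.
Variable K : Type.
Hypothesis Kinf : infinite_set [set: K].
Local Notation Wbeta := (wallman_beta hX K).
Local Notation Wbar := (wallman_bar hX K).

Lemma card_point_le (T : Type) (x : T) : [set x] #<= [set: K].
Proof.
have [e _] := nat_inj_infinite Kinf; have K0 : [set: K] !=set0 by exists (e 0%N).
by apply/(card_leT_injP _ K0); exists (fun=> e 0%N) => y z /set_mem -> /set_mem ->.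
Qed.

(** The union of kappa many witnesses of size at most kappa is again a witness; this is where kappa
    * kappa = kappa enters. *)
Lemma wallman_bar_subset (I : Type) (D : set I) (z : I -> wallman X) :
  D #<= [set: K] -> (forall i, D i -> Wbar (z i)) ->
  exists2 C : set X, C #<= [set: K] & z @` D `<=` closure (j @` C).
Proof.
move=> DK zW; have /choice[C CP] : forall i, exists C : set X, D i ->
    C #<= [set: K] /\ closure (j @` C) (z i).
  move=> i; have [/zW[C CK Cz]|nDi] := pselect (D i); first by exists C.
  by exists set0.
exists (\bigcup_(i in D) C i); first by apply: card_bigcup_le => // i /CP[].
move=> _ [i Di <-]; have [_] := CP _ Di; apply: closureS; apply: image_subset.
exact: bigcup_sup.
Qed.

(** All values of a map from [K] lie in one closed set cl j(C), which therefore contains its limits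
    along ultrafilters. *)
Lemma wallman_beta_bar : Wbeta = Wbar.
Proof.
apply/seteqP; split; last first.
  by move=> F [C CK]; exact: closure_wallman_beta.
apply: smallest_sub.
  move=> x p xW pU F pF.
  have [C CK xC] := wallman_bar_subset (card_lexx _) (fun k _ => xW k).
  exists C => //; apply: (@closed_cvg _ _ p _ x (closure (j @` C))) pF.
    exact: closed_closure.
  by apply: filterS filterT => k _; apply: xC; exists k.
move=> _ [x _ <-]; exists [set x]; first exact: card_point_le.
by rewrite image_set1; exact: subset_closure.
Qed.

End Cardinal.
End Wallman.

(** * The topology tau^* *)

Section Star.
Variables (K : Type) (Kinf : infinite_set [set: K]).
Variables (X : topologicalType) (hX : accessible_space X).
Local Notation j := (wallman_j hX).
Local Notation Wbeta := (wallman_beta hX K).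
Local Notation Wbar := (wallman_bar hX K).
Local Notation Wstar := (wallman_star hX K).
Local Notation jstar := (@wallman_star_j X hX K).
Local Notation val := (set_val : Wstar -> wallman X).
Implicit Types (C : set X) (U : set Wstar).

Lemma star_val_bar (p : Wstar) : Wbar (val p).
Proof. by rewrite -wallman_beta_bar//; exact: set_valP. Qed.

Lemma star_val_surj C F : C #<= [set: K] -> closure (j @` C) F ->
  exists p, val p = F.
Proof.
move=> CK clF.
by exists (exist _ F (mem_set (closure_wallman_beta CK clF))).
Qed.

(** Since cl j(C) lies in the image of [val], removing the preimage of [E] leaves the closed set cl
    j(C) minus [E]. *)
Lemma star_open_val (E : set (wallman X)) : open E -> open (val @^-1` E).
Proof.
move=> oE; split=> [|C CK].
  by have /continuousP := wallman_j_continuous (hX := hX); exact.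
rewrite (_ : _ `\` _ = closure (j @` C) `\` E).
  apply: preimage_closed => [F _|]; first exact: initial_continuous.
  by apply: closedI; [exact: closed_closure|exact: open_closedC].
apply/seteqP; split=> F [clF nF]; split=> //.
  move=> EF; apply: nF; have [p pF] := star_val_surj CK clF.
  by exists p => //=; rewrite pF.
by move=> [p Ep pF]; apply: nF; rewrite -pF.
Qed.

(** The definition of tau^* gives closedness in the subspace only; as cl j(C) is closed in the whole
    extension and contained in the subspace, the trace is closed in the whole extension. *)
Lemma star_trace_closed U C : open U -> C #<= [set: K] ->
  closed (closure (j @` C) `\` val @` U).
Proof.
move=> [_ hU] CK; have := hU C CK; rewrite -openC => -[E oE EU].
rewrite (_ : _ `\` _ = closure (j @` C) `&` ~` E).
  by apply: closedI; [exact: closed_closure|exact: open_closedC].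
have WF F : closure (j @` C) F -> F \in Wbar.
  by move=> clF; apply/mem_set; exists C.
apply/seteqP; split=> F [clF nF]; split=> //.
  move=> EF; have : (set_val @^-1` E) (exist _ F (WF _ clF) : set_type Wbar).
    exact: EF.
  by rewrite EU; apply.
move=> UF; apply: nF.
suff : (set_val @^-1` E) (exist _ F (WF _ clF) : set_type Wbar) by [].
by rewrite EU => -[].
Qed.

Lemma star_to_bar_continuous : exists2 idW : Wstar -> set_type Wbar,
  (forall p, set_val (idW p) = set_val p) & continuous idW.
Proof.
exists (fun p => exist _ (val p) (mem_set (star_val_bar p))) => //.
by apply/continuousP => _ [E oE <-]; exact: star_open_val.
Qed.

Lemma star_j_embedding : topological_embedding jstar.
Proof.
split=> [x y xy||U oU].
- exact: (wallman_j_inj (congr1 val xy)).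
- by apply/continuousP => V [].
- exists (val @^-1` wallman_base U).
  by apply: star_open_val; exact: open_wallman_base.
apply/seteqP; split=> [_ [x Ux <-]|p [/= Ux [x _ xE]]].
  by split; [exact/wallman_base_j|exists x].
by exists x => //; apply/(wallman_base_j hX _ oU); move: Ux; rewrite -xE.
Qed.

(** If [U] missed j(X), the closed set cl j(C) minus [U] would contain j(C), hence all of cl j(C),
    including a point of [U]. *)
Lemma star_j_dense : dense (range jstar).
Proof.
move=> U [p Up] oU; apply: contrapT => /nonemptyPn Uj0.
have [C CK Cp] := star_val_bar p.
have [_] : (closure (j @` C) `\` val @` U) (val p).
  apply: (star_trace_closed oU CK); apply: closureS Cp => _ [x Cx <-].
  split; first by apply: subset_closure; exists x.
  move=> [q Uq qx]; suff : (U `&` range jstar) q by rewrite Uj0.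
  by split=> //; exists x => //; exact: val_inj.
by apply; exists p.
Qed.

(** A small dense subset of [Z] lies in one closed set cl j(C), hence so does [Z], and there both
    topologies have the same traces. *)
Lemma star_small_embedding (Z : set (set_type Wbeta)) :
  density_le K (set_type Z) ->
  @topological_embedding (set_type Z) Wstar (fun z => set_val z).
Proof.
move=> [D Ddense DK]; pose v (z : set_type Z) : wallman X := val (set_val z).
have vcont : continuous v.
  by move=> z; apply: continuous_comp; exact: initial_continuous.
have [C CK DC] : exists2 C : set X, C #<= [set: K] &
    v @` D `<=` closure (j @` C).
  by apply: wallman_bar_subset => // z _; exact: star_val_bar.
have vC z : closure (j @` C) (v z).
  apply: contrapT => nz.
  have [||y [ny Dy]] := Ddense (v @^-1` (~` closure (j @` C))).
  - by exists z.
  - move/continuousP: vcont; apply.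
    by apply: closed_openC; exact: closed_closure.
  - by apply: ny; apply: DC; exists y.
split=> [||U].
- exact: val_inj.
- apply/continuousP => V oV.
  rewrite (_ : _ @^-1` V =
      v @^-1` (~` (closure (j @` C) `\` val @` V))).
    move/continuousP: vcont; apply.
    by apply: closed_openC; exact: star_trace_closed.
  apply/seteqP; split=> z /=; first by move=> Vz [_]; apply; exists (set_val z).
  by move=> /not_andP[//|/contrapT[q Vq /val_inj <-]].
- move=> [U1 [E oE <-] <-]; exists (val @^-1` E); first exact: star_open_val.
  apply/seteqP; split=> [_ [z Ez <-]|p [Ez [z _ zE]]].
    by split=> //; exists z.
  by exists z => //=; move: Ez; rewrite -zE.
Qed.


(** A cluster point in the Wallman topology is also one for tau^*: on cl j(C), the complement of the
    closed set cl j(C) minus [V] is contained in [V]. *)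
Lemma star_closure_compact C : C #<= [set: K] ->
  compact (val @^-1` closure (j @` C)).
Proof.
move=> CK G GP GC.
have cC : compact (closure (j @` C)).
  by apply: subclosed_compact (@wallman_compact X) _ => //; exact: closed_closure.
have [F [clF GF]] := cC (val @ G) _ GC.
have [p pF] := star_val_surj CK clF; exists p; split; first by rewrite /= pF.
move=> A U GA; rewrite nbhsE => -[V [oV Vp] VU].
have [||_ [[q [Aq Cq] <-] nq]] := GF (val @` (A `&` val @^-1` closure (j @` C)))
    (~` (closure (j @` C) `\` val @` V)).
- rewrite /= /fmap /=; apply: filterS (filterI GA GC) => q Aq.
  by exists q.
- apply: open_nbhs_nbhs; split.
    by apply: closed_openC; exact: star_trace_closed.
  by move=> [_]; apply; exists p.
exists q; split=> //; apply: VU; have /not_andP[//|/contrapT[r Vr]] := nq.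
by move=> /val_inj <-.
Qed.

Lemma star_kappa_bounded : kappa_bounded K Wstar.
Proof.
move=> D DK; have [C CK DC] : exists2 C : set X, C #<= [set: K] &
    val @` D `<=` closure (j @` C).
  by apply: wallman_bar_subset => // p _; exact: star_val_bar.
apply: (subclosed_compact _ (star_closure_compact CK)).
  exact: closed_closure.
have /closure_id -> : closed (val @^-1` closure (j @` C)).
  rewrite -openC; apply: (@star_open_val (~` closure (j @` C))).
  by apply: closed_openC; exact: closed_closure.
by apply: closureS => p Dp; apply: DC; exists p.
Qed.

Lemma star_hausdorff : kappa_normal K X -> hausdorff_space Wstar.
Proof.
move=> Xn; rewrite open_hausdorff => p q pq.
(* Indexing the two points by [bool] places both in a single cl j(C). *)
have [C CK pqC] : exists2 C : set X, C #<= [set: K] &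
    (fun b : bool => val (if b then p else q)) @` setT `<=` closure (j @` C).
  apply: wallman_bar_subset => //.
    apply: (@card_le_trans _ _ _ [set: nat]); first exact: countableP.
    exact/infiniteP.
  by move=> b _; exact: star_val_bar.
have /closure_wallman_j Cp : closure (j @` C) (val p) by apply: pqC; exists true.
have /closure_wallman_j Cq : closure (j @` C) (val q) by apply: pqC; exists false.
have [A [pA nqA]] : exists A, wallman_family (val p) A /\ ~ wallman_family (val q) A.
  apply: contrapT => nA; move/eqP: pq; apply; apply: val_inj.
  apply: wallman_eq => A pA; apply: contrapT => nqA; apply: nA.
  by exists A.
have clA := cuf_closed (wallmanP (val p)) pA.
have [B qB AB0] := wallman_disjoint clA nqA.
have clB := cuf_closed (wallmanP (val q)) qB.
(* Both ultrafilters contain cl C, so cutting [A] and [B] down to it keeps them as members and makes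
   kappa-normality applicable. *)
have [|||||V [W [oV oW AV BW VW0]]] := Xn C CK (A `&` closure C) (B `&` closure C).
- by apply: closedI => //; exact: closed_closure.
- by apply: closedI => //; exact: closed_closure.
- by move=> x [].
- by move=> x [].
- by rewrite setIACA AB0 set0I.
exists (val @^-1` wallman_base V, val @^-1` wallman_base W); split=> /=.
- apply/mem_set; exists (A `&` closure C) => //.
  exact: (cuf_setI (wallmanP (val p))).
- apply/mem_set; exists (B `&` closure C) => //.
  exact: (cuf_setI (wallmanP (val q))).
- by apply: star_open_val; exact: open_wallman_base.
- by apply: star_open_val; exact: open_wallman_base.
- apply/eqP; rewrite -subset0 => r VWr.
  by have := wallman_baseI VWr; rewrite VW0 wallman_base0.
Qed.

End Star.

(** * Extension of continuous maps *)

(** Otherwise the traces of the closures cl G on the compact set T minus O would generate a proper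
    filter. Its cluster point differs from [y], and separating the two by open sets gives a
    contradiction. *)
Lemma hausdorff_compact_regular (Y : topologicalType) (T O : set Y) (y : Y) :
  hausdorff_space Y -> compact T -> open O -> O y ->
  exists G, [/\ open G, G y & closure G `&` T `<=` O].
Proof.
move=> hY cT oO Oy; apply: contrapT => nG.
pose L : set_system Y :=
  filter_from (open_nbhs y) (fun G => closure G `&` (T `&` ~` O)).
have LP : ProperFilter L.
  apply: filter_from_proper => [|G [oG Gy]].
    apply: filter_from_filter; first by exists setT; exact: open_nbhsT.
    move=> G H oG oH; exists (G `&` H); first exact: open_nbhsI.
    by move=> z [/closureI[Gz Hz] TOz].
  apply: contrapT => /nonemptyPn G0; apply: nG; exists G; split=> //.
  move=> z [Gz Tz]; apply: contrapT => nOz.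
  by have : (closure G `&` (T `&` ~` O)) z by []; rewrite G0.
have cTO : compact (T `&` ~` O).
  by apply: compact_closedI => //; exact: open_closedC.
have [|z [[Tz nOz] Lz]] := cTO L LP.
  by exists setT; [exact: open_nbhsT|move=> z []].
have [eyz|yz] := eqVneq y z; first by apply: nOz; rewrite -eyz.
move: hY; rewrite open_hausdorff => /(_ _ _ yz)[[G H] /=].
move=> [/set_mem Gy /set_mem Hz] [oG oH GH0].
have [||w [[clGw _] Hw]] := Lz (closure G `&` (T `&` ~` O)) H.
- by exists G.
- exact: open_nbhs_nbhs.
have [|v] := clGw H; first exact: open_nbhs_nbhs.
by rewrite (eqP GH0).
Qed.

Section Extension.
Variables (K : Type) (Kinf : infinite_set [set: K]).
Variables (X : topologicalType) (hX : accessible_space X).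
Variables (Y : topologicalType) (hY : hausdorff_space Y).
Hypothesis bY : kappa_bounded K Y.
Variables (f : X -> Y) (fcont : continuous f).
Local Notation j := (wallman_j hX).
Local Notation Wstar := (wallman_star hX K).
Local Notation jstar := (@wallman_star_j X hX K).
Local Notation val := (set_val : Wstar -> wallman X).

(** Convergence to [y] of the filter generated by the images f(A), for [A] in [F]. *)
Definition wallman_limit (F : wallman X) (y : Y) :=
  forall O, open O -> O y -> wallman_base (f @^-1` O) F.

Lemma open_preimage_f O : open O -> open (f @^-1` O).
Proof. by move/continuousP: fcont; exact. Qed.

Lemma compact_closure_f (C : set X) : C #<= [set: K] -> compact (closure (f @` C)).
Proof. by move=> CK; apply: bY; exact: card_le_trans (card_image_le _ _) CK. Qed.

Lemma wallman_closure_f (C : set X) (F : wallman X) : closure (j @` C) F ->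
  wallman_family F (f @^-1` closure (f @` C)).
Proof.
move=> /closure_wallman_j FC; apply: (wallman_setS FC).
  by apply: preimage_closed => //; exact: closed_closure.
by move=> x Cx O /fcont/Cx[c [Cc Oc]]; exists (f c).
Qed.

Lemma wallman_limit_closure (F : wallman X) (y : Y) (T : set Y) : closed T ->
  wallman_limit F y -> wallman_family F (f @^-1` T) -> T y.
Proof.
move=> cT Fy FT; apply: contrapT => nTy.
have [A FA AT] := Fy _ (closed_openC cT) nTy.
by have [x [Tx /AT]] := wallman_meet FT FA.
Qed.

(* The filter f(F) clusters in the compact set cl f(C); regularity of that set
   turns the cluster point into a limit, because F is a closed ultrafilter. *)
Lemma wallman_limit_exists (p : Wstar) : exists y, wallman_limit (val p) y.
Proof.
have [C CK /wallman_closure_f FT] := star_val_bar Kinf p.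
set F := val p in FT *.
pose L : set_system Y := filter_from (wallman_family F) (fun A => f @` A).
have LP : ProperFilter L.
  apply: filter_from_proper => [|A FA].
    apply: filter_from_filter; first by exists setT; exact: wallman_setT.
    move=> A B FA FB; exists (A `&` B); first exact: (cuf_setI (wallmanP F)).
    by move=> _ [x [Ax Bx] <-]; split; exists x.
  by have [x [Ax _]] := wallman_meet FA FA; exists (f x); exists x.
have cT := compact_closure_f CK.
have [|y [Ty Ly]] := cT L LP; first by exists (f @^-1` closure (f @` C)) => // _ [x Tx <-].
exists y => O oO Oy.
have [G [oG Gy GTO]] := hausdorff_compact_regular hY cT oO Oy.
have FG : wallman_family F (f @^-1` closure G).
  apply: (cuf_max (wallmanP F)).
    by apply: preimage_closed => //; exact: closed_closure.
  move=> A FA; have [||_ [[x Ax <-] Gx]] := Ly (f @` A) G; first by exists A.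
    exact: open_nbhs_nbhs.
  by exists x; split=> //; exact: subset_closure.
exists (f @^-1` closure G `&` f @^-1` closure (f @` C)).
  exact: (cuf_setI (wallmanP F)).
by move=> x /GTO.
Qed.

Lemma wallman_limit_j x y : wallman_limit (j x) y -> y = f x.
Proof.
move=> jy; apply: (@wallman_limit_closure (j x) y [set f x]) => //.
  exact/accessible_closed_set1/hausdorff_accessible.
split=> //; apply: preimage_closed => //.
exact/accessible_closed_set1/hausdorff_accessible.
Qed.

(** On j(X) the map is [f]. On cl j(C), choose [G] around g(p) with cl G and cl f(C) meeting inside
    [O]; every point of cl j(C) in the basic neighborhood given by the preimage of [G] has its limit
    in both closures, hence in [O]. *)
Lemma star_limit_continuous (g : Wstar -> Y) :
  (forall p, wallman_limit (val p) (g p)) -> continuous g.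
Proof.
move=> gP; apply/continuousP => O oO.
have gj x : g (jstar x) = f x by apply: wallman_limit_j; exact: (gP (jstar x)).
split=> [|C CK].
  rewrite (_ : _ @^-1` _ = f @^-1` O); first exact: open_preimage_f.
  by apply/seteqP; split=> x; rewrite /= gj.
apply: preimage_closed => [F _|]; first exact: initial_continuous.
rewrite -openC openE => F nF.
have [Cx|nCx] := pselect (closure (j @` C) F); last first.
  apply: (@filterS _ _ _ (~` closure (j @` C))); first by move=> G nG [].
  apply: open_nbhs_nbhs; split=> //.
  by apply: closed_openC; exact: closed_closure.
have [p pF] := star_val_surj CK Cx.
have Op : O (g p).
  by apply: contrapT => nO; apply: nF; split=> // -[q Oq qF]; apply: nO;
    rewrite (_ : p = q)//; apply: val_inj; rewrite -[RHS]/(val q) qF.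
have [G [oG Gp GTO]] := hausdorff_compact_regular hY (compact_closure_f CK) oO Op.
apply: (@filterS _ _ _ (wallman_base (f @^-1` G))).
  move=> H HG [CH]; have [q qH] := star_val_surj CK CH.
  rewrite -{}qH in CH HG *; case: HG => A qA AG; apply.
  exists q => //; apply: GTO; split.
    apply: (wallman_limit_closure (@closed_closure _ _) (gP q)).
    apply: (wallman_setS qA) => [|x /AG Gx]; last exact: subset_closure.
    by apply: preimage_closed => //; exact: closed_closure.
  apply: (wallman_limit_closure (@closed_closure _ _) (gP q)).
  exact: wallman_closure_f.
apply: open_nbhs_nbhs; split.
  by apply: open_wallman_base; exact: open_preimage_f.
by rewrite -pF; exact: gP.
Qed.

Lemma star_extension : exists! g : Wstar -> Y, continuous g /\ f = g \o jstar.
Proof.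
have /choice[g gP] := wallman_limit_exists; exists g; split.
  split; first exact: star_limit_continuous.
  by apply/funext => x; apply/esym/wallman_limit_j; exact: (gP (jstar x)).
(* Extensions that differ at [p] have disjoint values on a neighborhood of [p], which meets the
   dense set j(X), where both equal [f]. *)
move=> h [hcont fh]; apply/funext => p; apply: contrapT => /eqP gh.
have gcont := star_limit_continuous gP.
move: hY; rewrite open_hausdorff => /(_ _ _ gh)[[G H] /=].
move=> [/set_mem Gp /set_mem Hp] [oG oH GH0].
have [||q [[Gq Hq] [x _ xE]]] := star_j_dense Kinf (O := g @^-1` G `&` h @^-1` H).
- by exists p.
- by apply: openI; [move/continuousP: gcont|move/continuousP: hcont]; exact.
suff : (G `&` H) (f x) by rewrite (eqP GH0).
split; last by rewrite fh /= xE.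
by rewrite -(wallman_limit_j (gP (jstar x))) xE.
Qed.

End Extension.

Theorem theorem9p1 (K : Type) (K_infinite : infinite_set [set: K])
    (X : topologicalType) (hX : accessible_space X) :
  (* (1) *)
  (exists2 idW : wallman_star hX K -> set_type (wallman_bar hX K),
     (forall p, set_val (idW p) = set_val p) & continuous idW) /\
  (* (2) *)
  topological_embedding (wallman_star_j hX K) /\
  (* (3) *)
  dense (range (wallman_star_j hX K)) /\
  (* (4) *)
  (forall Z : set (set_type (wallman_beta hX K)),
     density_le K (set_type Z) ->
     @topological_embedding (set_type Z) (wallman_star hX K)
       (fun z => set_val z)) /\
  (* (5) *)
  kappa_bounded K (wallman_star hX K) /\
  (* (6) *)
  (forall Y : topologicalType, hausdorff_space Y -> kappa_bounded K Y ->
     forall f : X -> Y, continuous f ->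
     exists! fbar : wallman_star hX K -> Y,
       continuous fbar /\ f = fbar \o wallman_star_j hX K) /\
  (* (7) *)
  (is_reflection (hausdorff_kappa_bounded K) (wallman_star_j hX K) <->
     hausdorff_space (wallman_star hX K)) /\
  (* (8) *)
  (kappa_normal K X ->
     is_reflection (hausdorff_kappa_bounded K) (wallman_star_j hX K)).
Proof.
have ext (Y : topologicalType) (hY : hausdorff_space Y) (bY : kappa_bounded K Y)
  (f : X -> Y) (fcont : continuous f) := star_extension K_infinite hX hY bY fcont.
(* Properties (2), (5) and (6) give all of the reflection except the Hausdorff axiom, which settles
   (7) and reduces (8) to separation. *)
have refl : hausdorff_space (wallman_star hX K) ->
    is_reflection (hausdorff_kappa_bounded K) (wallman_star_j hX K).
  move=> hW; split; first by split=> //; exact: star_kappa_bounded.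
    by have [] := star_j_embedding K hX.
  by move=> Y [hY bY] f fcont; exact: ext.
split; first exact: star_to_bar_continuous.
split; first exact: star_j_embedding.
split; first exact: star_j_dense.
split; first exact: star_small_embedding.
split; first exact: star_kappa_bounded.
split; first exact: ext.
split; first by split=> [[[]]|].
by move=> Xn; apply: refl; exact: star_hausdorff.
Qed.
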